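(* For every randomized stopping time $\rho=(\rho_t)_{t\in[0,T]}$ there exists a mixed stopping time $\mu:\Omega\times I\to[0,T]$ that is equivalent to $\rho$, i.e. such that $\delta_\mu=\delta_\rho$.
   Context: Setting: $T>0$; $I=[0,1]$ is equipped with its Borel $\sigma$-algebra $\mathcal{B}$ and Lebesgue measure $\lambda$. $(\Omega,\mathcal{F},P)$ is a probability space with a filtration $(\mathcal{F}_t)_{t\in[0,T]}$ satisfying the usual conditions: $\mathcal{F}=\bigvee_{t\in[0,T]}\mathcal{F}_t$; $\mathcal{F}_0$ contains all $P$-null sets; and $\mathcal{F}_t=\bigcap_{s>t}\mathcal{F}_s$ (right continuity). Measurability with respect to a $\sigma$-algebra always means with respect to its completion under the underlying measure ($P$ on $\Omega$, $P\otimes\lambda$ on $\Omega\times I$). A mixed stopping time is a function $\mu:\Omega\times I\to[0,T]$ such that $\{(\omega,r)\in\Omega\times I:\mu(\omega,r)\le t\}$ is $(\mathcal{F}_t\otimes\mathcal{B})$-measurable for every $t\in[0,T]$. A randomized stopping time is an adapted $[0,1]$-valued process $\rho=(\rho_t)_{t\in[0,T]}$ with right-continuous nondecreasing paths and $\rho_T\equiv 1$. A mixed stopping time $\mu$ defines the probability measure $\delta_\mu$ on $\Omega\times[0,T]$ (with product $\sigma$-algebra $\mathcal{F}\otimes$ Borel) by $\delta_\mu(A\times[0,t])=(P\otimes\lambda)(\{(\omega,r):\omega\in A,\ \mu(\omega,r)\le t\})$ for all $t\in[0,T]$, $A\in\mathcal{F}$; i.e. $\delta_\mu$ is the push-forward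 of $P\otimes\lambda$ under $(\omega,r)\mapsto(\omega,\mu(\omega,r))$. A randomized stopping time $\rho$ defines the probability measure $\delta_\rho$ on $\Omega\times[0,T]$ by $\delta_\rho(A\times[0,t])=\int_A\rho_t(\omega)\,P(d\omega)$ for all $t\in[0,T]$, $A\in\mathcal{F}$. Two such stopping times $\eta_1,\eta_2$ are equivalent if $\delta_{\eta_1}=\delta_{\eta_2}$. *)

(* Defs.v *)
From HB Require Import structures.
From mathcomp Require Import all_boot all_order all_algebra.
From mathcomp Require Import all_classical all_reals all_analysis.

Set Implicit Arguments.
Unset Strict Implicit.
Unset Printing Implicit Defensive.
Import Order.TTheory GRing.Theory Num.Theory.
Import numFieldNormedType.Exports.

Local Open Scope classical_set_scope.
Local Open Scope ring_scope.

(* The spaces Omega x I and Omega x [0,T] are handled as the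
   subsets Omega x [0,1] and Omega x [0,T] of Omega x R; time-indexed objects
   are functions on R of which only the values on [0,T] matter. *)

(* The completion of the sigma-algebra G under m: both the set B and the null
   set Z are taken in G, so that for a sub-sigma-algebra G this is the
   completion under the restriction of m to G. *)
Definition completion {R : realType} {X : Type} (m : set X -> \bar R)
    (G : set (set X)) : set (set X) :=
  [set A | exists B Z N, [/\ G B, G Z, m Z = 0%E, N `<=` Z & A = B `|` N]].

Section StoppingTimes.
Context {d : measure_display} {Omega : measurableType d} {R : realType}.
Variables (P : probability Omega R) (T : R) (F : R -> set (set Omega)).

Record filtration : Prop := Filtration {
  filtration_sigma : forall t, t \in `[0, T] -> sigma_algebra setT (F t);
  filtration_sub : forall t, t \in `[0, T] -> F t `<=` measurable;
  filtration_mono : forall s t, s \in `[0, T] -> t \in `[0, T] ->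
    s <= t -> F s `<=` F t }.

(* Null sets are the members of the ambient sigma-algebra of probability 0,
   which is not assumed to be complete. *)
Record usual_conditions : Prop := UsualConditions {
  usual_join : measurable = <<s \bigcup_(t in `[0, T]) F t >>;
  usual_null : forall N, measurable N -> P N = 0%E -> F 0 N;
  usual_right : forall t, t \in `[0, T[ ->
    F t = \bigcap_(s in `]t, T]) F s }.

Definition prod_borel (G : set (set Omega)) :
    set (set (Omega * measurableTypeR R)) :=
  <<s [set A `*` B | A in G & B in measurable] >>.

Definition Plambda :
    {measure set (Omega * measurableTypeR R)%type -> \bar R} :=
  (P \x @lebesgue_measure R)%E.

Record mixed_stopping_time (mu : Omega * R -> R) : Prop := MixedStoppingTime {
  mixed_range : forall w r, r \in `[0, 1] -> mu (w, r) \in `[0, T];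
  mixed_measurable : forall t, t \in `[0, T] ->
    completion Plambda (prod_borel (F t))
      [set x : Omega * R | x.2 \in `[0, 1] /\ mu x <= t] }.

Record randomized_stopping_time (rho : R -> Omega -> R) : Prop :=
  RandomizedStoppingTime {
  rand_range : forall t w, t \in `[0, T] -> rho t w \in `[0, 1];
  rand_adapted : forall t, t \in `[0, T] -> forall B : set R, measurable B ->
    completion P (F t) (rho t @^-1` B);
  rand_mono : forall w s t, s \in `[0, T] -> t \in `[0, T] ->
    s <= t -> rho s w <= rho t w;
  rand_right : forall w t, t \in `[0, T[ -> rho^~ w @ t^'+ --> rho t w;
  rand_end : forall w, rho T w = 1 }.

(* The set on the right-hand side is only measurable for the completion of the
   product sigma-algebra; the outer measure m^* is the completed measure there. *)
Definition is_delta_mixed (mu : Omega * R -> R)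
    (delta : probability (Omega * measurableTypeR R)%type R) : Prop :=
  forall t A, t \in `[0, T] -> measurable A ->
    delta (A `*` `[0, t]) =
    (Plambda^*)%mu [set x : Omega * R | [/\ A x.1, x.2 \in `[0, 1] & mu x <= t]].

(* rho t is a nonnegative function that is measurable for the completion of P;
   the integral, a supremum over simple functions below it, is then its integral
   under the completed measure. *)
Definition is_delta_randomized (rho : R -> Omega -> R)
    (delta : probability (Omega * measurableTypeR R)%type R) : Prop :=
  forall t A, t \in `[0, T] -> measurable A ->
    delta (A `*` `[0, t]) = (\int[P]_(w in A) (rho t w)%:E)%E.

(* delta_mu = delta_rho, each delta being the measure satisfying its defining
   equations. It is the only one: the equations at t = T put all the mass on
   Omega x [0,T], and the sets A `*` `[0, t] form a generating pi-system there. *)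
Definition equivalent (mu : Omega * R -> R) (rho : R -> Omega -> R) : Prop :=
  exists delta : probability (Omega * measurableTypeR R)%type R,
    is_delta_mixed mu delta /\ is_delta_randomized rho delta.

End StoppingTimes.

(* Main.v *)
Require Import Defs.
From HB Require Import structures.
From mathcomp Require Import all_boot all_order all_algebra.
From mathcomp Require Import all_classical all_reals all_analysis.
From mathcomp Require Import measurable_realfun.
Import Order.TTheory GRing.Theory Num.Theory.
Import numFieldNormedType.Exports.
Local Open Scope classical_set_scope.
Local Open Scope ring_scope.

(** The mixed stopping time is the pathwise generalized inverse of [rho]: up
    to null sets, [mu (w, r)] is the first [t] in [[0, T]] with
    [r <= rho t w]. Monotonicity and right continuity of the path make the
    infimum attained ([first_passage_le]), so that

        mu (w, r) <= t   if and only if   r <= rho t w.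

    Sampling [r] uniformly in [[0, 1]] thus gives [mu (w, .)] the distribution
    function [t |-> rho t w], which is what equality of the two measures
    requires once it is integrated over [w]. The same equivalence turns
    [{mu <= t}] into the region under the graph of [rho t], and that region is
    product measurable as soon as [rho t] is measurable.

    What needs care is completion: [rho t] is only measurable for the completed
    [F t], while the common measure has to be an honest measure on the
    uncompleted product. Each [rho t] has an [F t]-measurable version
    ([completion_measurable_version]). Discarding the exceptional null sets
    for a countable dense set of times, and giving [mu] the constant value [T]
    on the resulting null set [N], makes [mu] jointly measurable
    ([measurable_inverse_time]): by density, [{mu < y}] is off [N] a countable
    union of regions under graphs. The common measure is then the image of [P]
    times the uniform law under [(w, r) |-> (w, mu (w, r))]. The usual
    conditions put [N] into every [F t], so that the modification does not
    affect the mixed stopping time property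
    ([mixed_stopping_time_inverse_time]).

    The integral of [rho t], a possibly nonmeasurable function, is compared
    with that of a measurable function equal to it almost everywhere by
    [ge0_integral_null_modification]. *)

(** * Generalized inverse of a right-continuous nondecreasing path *)

Lemma dense_sequence (R : realType) :
  exists q : nat -> R, forall x y, x < y -> exists n, x < q n < y.
Proof.
exists (fun n => ratr (odflt 0%R (unpickle n))) => x y xy.
have [p] := rat_in_itvoo xy.
by rewrite in_itv/= => xpy; exists (pickle p); rewrite pickleK.
Qed.

Section first_passage.
Context {R : realType}.
Implicit Types (T r t : R) (phi : R -> R).

Definition first_passage T phi r : R :=
  inf [set t | t \in `[0, T] /\ r <= phi t].

Lemma first_passage_range T phi r : 0 <= T -> r <= phi T ->
  first_passage T phi r \in `[0, T].
Proof.
move=> T0 rT; rewrite in_itv/=.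
have ne : [set t | t \in `[0, T] /\ r <= phi t] T.
  by split=> //; rewrite in_itv/= T0 lexx.
have lb : lbound [set t | t \in `[0, T] /\ r <= phi t] 0.
  by move=> t [/itvP->].
by rewrite lb_le_inf//=; [apply: ge_inf => //; exists 0 | exists T].
Qed.

(** If the path is still below [r] at time [t], right continuity keeps it below
    [r] until some [s > t], and by monotonicity every time in the defining set
    is then at least [s]; hence the infimum exceeds [t]. *)
Lemma first_passage_le T phi r t :
    (forall s t, s \in `[0, T] -> t \in `[0, T] -> s <= t -> phi s <= phi t) ->
    (forall t, t \in `[0, T[ -> phi @ t^'+ --> phi t) ->
    r <= phi T -> t \in `[0, T] ->
  (first_passage T phi r <= t) = (r <= phi t).
Proof.
move=> mono rc rT tT; have /andP[t0 tleT] : 0 <= t <= T by rewrite !(itvP tT).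
apply/idP/idP => [ht|rt]; last first.
  by apply: ge_inf => //; exists 0 => s [/itvP->].
rewrite leNgt; apply/negP => phitr.
have tltT : t < T.
  rewrite lt_neqAle tleT andbT; apply: contraTneq rT => <-.
  by rewrite -ltNge.
have tI : t \in `[0, T[ by rewrite in_itv/= t0.
have [s [phisr ts sT]] : exists s, [/\ phi s < r, t < s & s < T].
  near t^'+ => s; exists s; split; near: s.
  - exact: (rc t tI _ (lt_nbhsl phitr)).
  - exact: nbhs_right_gt.
  - exact: nbhs_right_lt.
suff : s <= first_passage T phi r by rewrite leNgt (le_lt_trans ht ts).
apply: lb_le_inf.
  by exists T; split=> //; rewrite in_itv/= lexx (le_trans t0 tleT).
move=> u [uT ru]; rewrite leNgt; apply/negP => us.
have : phi u <= phi s.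
  by apply: mono (ltW us) => //; rewrite in_itv/= (ltW sT) (le_trans t0 (ltW ts)).
by rewrite leNgt (lt_le_trans phisr ru).
Unshelve. all: by end_near. Qed.

End first_passage.

(** * Measurable versions for a completed sigma-algebra *)

Section completion.
Context {d : measure_display} {X : measurableType d} {R : realType}.
Variable m : {measure set X -> \bar R}.

Lemma null_bigcup (Z : nat -> set X) :
    (forall n, measurable (Z n)) -> (forall n, m (Z n) = 0%E) ->
  m (\bigcup_n Z n) = 0%E.
Proof.
move=> mZ Z0; have mU : measurable (\bigcup_n Z n) by exact: bigcupT_measurable.
apply/(negligibleP _ mU).
by apply: negligible_bigcup => n; apply: (negligibleP _ (mZ n)).2; exact: Z0.
Qed.

(** Only the countably many sets [{f < q}], with [q] in a dense sequence, have to
    be corrected by null sets; off the union [Z] of these the sublevel sets of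
    [f] are countable unions of members of [G]. *)
Lemma completion_measurable_version (G : set (set X)) (f : X -> R) :
    sigma_algebra setT G -> G `<=` measurable ->
    (forall B, measurable B -> completion m G (f @^-1` B)) ->
  exists g Z, [/\ forall B, measurable B -> G (g @^-1` B), G Z, m Z = 0%E &
    forall x, ~ Z x -> f x = g x].
Proof.
move=> sG Gm fG; have [q qdense] := dense_sequence R.
have [G0 GC GU] := sG.
have [_ _ _ GI] := (sigma_algebraP (fun A _ => @subsetT _ A)).1 sG.
have /choice[BZ hBZ] : forall n, exists BZ : set X * set X,
    [/\ G BZ.1, G BZ.2, m BZ.2 = 0%E &
      forall x, ~ BZ.2 x -> (f x < q n) <-> BZ.1 x].
  move=> n; have [B [Z [N [GB GZ Z0 NZ fE]]]] :=
    fG _ (@measurable_itv R `]-oo, q n[).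
  exists (B, Z); split => //= x Zx.
  have -> : (f x < q n) <-> (f @^-1` `]-oo, q n[) x by rewrite /= in_itv.
  by rewrite fE; split=> [[//|/NZ]|]; [|left].
pose Z := \bigcup_n (BZ n).2.
have GZ : G Z by apply: GU => n; have [] := hBZ n.
(* [Z] lies in [G], so a constant value there keeps [g] measurable for [G]. *)
pose g x := if x \in Z then 0 else f x.
exists g, Z; split=> //; last by move=> x Zx; rewrite /g memNset.
- have mg : measurable_fun [set: g_sigma_algebraType G] (g : g_sigma_algebraType G -> R).
    apply: (measurability _ (RGenInftyO.measurableE R)) => //=.
    move=> _ [_ [y ->] <-].
    rewrite setTI; apply: sub_sigma_algebra.
    have -> : g @^-1` `]-oo, y[ =
        (\bigcup_n (if q n <= y then (BZ n).1 `\` Z else set0)) `|`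
        (if 0 < y then Z else set0).
      apply/seteqP; split=> x /=; rewrite in_itv/= /g.
        case: ifPn => [/set_mem Zx y0|/negP Zx fy]; first by right; rewrite y0.
        have {}Zx : ~ Z x by move=> /mem_set.
        have [n /andP[fq qy]] := qdense _ _ fy.
        left; exists n => //; rewrite (ltW qy); split=> //.
        have [_ _ _ /(_ x)] := hBZ n; move=> <- // Znx.
        by apply: Zx; exists n.
      move=> [[n _]|].
        case: ifPn => // qy [Bx Zx]; rewrite memNset//.
        apply: lt_le_trans qy; have [_ _ _ /(_ x)->//] := hBZ n.
        by move=> Znx; apply: Zx; exists n.
      by case: ifPn => // y0 Zx; rewrite mem_set.
    rewrite -bigcup2E; apply: (GU) => -[|[|n]] /=.
    + apply: (GU) => n; case: ifPn => // _; rewrite setDE; apply: GI.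
        by have [] := hBZ n.
      by rewrite -setTD; exact: GC.
    + by case: ifPn.
    + by [].
  move=> B mB; have := mg measurableT B mB; rewrite setTI.
  by rewrite /measurable/= sigma_algebra_id.
- by apply: null_bigcup => n; have [_ /Gm ? ? _] := hBZ n.
Qed.

End completion.


(** * Measurability of the region under a graph *)

Section subgraph.
Context {d : measure_display} {X : measurableType d} {R : realType}.

Lemma prod_borel_sub (G : set (set X)) :
  G `<=` measurable -> prod_borel (R := R) G `<=` measurable.
Proof.
move=> GX; rewrite measurable_prod_measurableType.
apply: sub_sigma_algebra2 => _ [A GA [B mB <-]].
by exists A; [exact: GX | exists B].
Qed.

(** Regarding [G] as the sigma-algebra of a measurable space gives access, for a
    sub-sigma-algebra, to the calculus of measurable functions. *)
Lemma prod_borelE (G : set (set X)) : sigma_algebra setT G ->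
  prod_borel (R := R) G =
  (measurable : set (set (g_sigma_algebraType G * measurableTypeR R))).
Proof.
by move=> sG; rewrite measurable_prod_measurableType measurable_g_measurableTypeE.
Qed.

Lemma prod_borel_subgraph (G : set (set X)) (g : X -> R) :
    sigma_algebra setT G -> (forall B, measurable B -> G (g @^-1` B)) ->
  prod_borel G [set x : X * R | x.2 \in `[0, 1] /\ x.2 <= g x.1].
Proof.
move=> sG mg; rewrite prod_borelE//.
have mg' : measurable_fun [set: g_sigma_algebraType G]
    (g : g_sigma_algebraType G -> R).
  by move=> _ B mB; rewrite setTI; apply: sub_sigma_algebra; exact: mg.
pose f1 (x : g_sigma_algebraType G * measurableTypeR R) : R := x.2.
pose f2 (x : g_sigma_algebraType G * measurableTypeR R) : R := g x.1.
have m1 : measurable_fun setT f1 by exact: measurable_snd.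
have m2 : measurable_fun setT f2 by exact: measurableT_comp.
have -> : [set x : X * R | x.2 \in `[0, 1] /\ x.2 <= g x.1] =
    (setT `&` f1 @^-1` `[0, 1]) `&` [set x | f1 x <= f2 x].
  by rewrite setTI.
apply: measurableI; first exact: m1.
have mtrue : measurable [set true] by [].
have := measurable_fun_ler m1 m2 measurableT mtrue.
by rewrite setTI.
Qed.

End subgraph.

(** * Integrals of nonmeasurable functions *)

Section integral_modification.
Context {d : measure_display} {X : measurableType d} {R : realType}.
Variable m : {measure set X -> \bar R}.
Local Open Scope ereal_scope.

(** The integral of a nonnegative function is the supremum over the simple
    functions below it, hence monotone without any measurability. *)
Lemma ge0_le_integral_nonmeasurable (f g : X -> \bar R) :
    (forall x, 0 <= f x) -> (forall x, f x <= g x) ->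
  \int[m]_x f x <= \int[m]_x g x.
Proof.
move=> f0 fg; rewrite !ge0_integralTE//; last first.
  by move=> x; exact: le_trans (f0 x) (fg x).
apply: le_ereal_sup => _ [h/= hf <-]; exists h => // x.
exact: le_trans (hf x) (fg x).
Qed.

(** [f] lies between the two measurable functions that agree with [g] off [Z] and
    are [0], respectively [+oo], on [Z]; both have the integral of [g]. *)
Lemma ge0_integral_null_modification (Z : set X) (f g : X -> \bar R) :
    measurable Z -> m Z = 0 -> measurable_fun setT g ->
    (forall x, 0 <= f x) -> (forall x, 0 <= g x) ->
    (forall x, ~ Z x -> f x = g x) ->
  \int[m]_x f x = \int[m]_x g x.
Proof.
move=> mZ Z0 mg f0 g0 fg.
pose patchg c x := if x \in Z then c else g x.
have mpatch c : measurable_fun setT (patchg c).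
  apply: measurable_fun_ifT => //; apply: (measurable_fun_bool true).
  rewrite setTI (_ : _ @^-1` _ = Z)//.
  by apply/seteqP; split=> x /=; [exact: set_mem | exact: mem_set].
have Epatch c : 0 <= c -> \int[m]_x patchg c x = \int[m]_x g x.
  move=> c0; apply: ge0_ae_eq_integral => //.
    by move=> x _; rewrite /patchg; case: ifPn.
  exists Z; split=> // x /= /not_implyP[_]; rewrite /patchg.
  by case: ifPn => // /set_mem.
apply/eqP; rewrite eq_le; apply/andP; split.
  rewrite -(Epatch +oo)//; apply: ge0_le_integral_nonmeasurable => // x.
  rewrite /patchg; case: ifPn => [_|/negP Zx]; first exact: leey.
  by rewrite fg// => /mem_set.
rewrite -(Epatch 0)//; apply: ge0_le_integral_nonmeasurable => x.
  by rewrite /patchg; case: ifPn.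
rewrite /patchg; case: ifPn => [//|/negP Zx].
by rewrite fg// => /mem_set.
Qed.

End integral_modification.

(** * Lebesgue measure on the unit strip as a probability *)

Section uniform.
Context {R : realType}.
Local Open Scope ereal_scope.

Lemma uniform_prob01E (B : set (measurableTypeR R)) : measurable B ->
  uniform_prob (@ltr01 R) B = lebesgue_measure (B `&` `[0%R, 1%R]).
Proof.
move=> mB; rewrite /uniform_prob integral_uniform_pdf.
rewrite (eq_integral (fun=> 1)); last first.
  move=> x /set_mem[_]; rewrite /= in_itv/= /uniform_pdf => ->.
  by rewrite subr0 invr1.
by rewrite integral_cst ?mul1e//; apply: measurableI.
Qed.

(** [Plambda] is infinite, so a probability has to be built from the uniform
    law; this lemma transfers its values back to [Plambda]. *)
Lemma product_uniform_prob01E {d : measure_display} {X : measurableType d}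
    (P : probability X R) (E : set (X * measurableTypeR R)) : measurable E ->
  (P \x uniform_prob (@ltr01 R)) E =
  Plambda P (E `&` [set x | x.2 \in `[0%R, 1%R]]).
Proof.
move=> mE; apply: eq_integral => w _ /=.
rewrite uniform_prob01E; last exact: measurable_xsection.
congr lebesgue_measure; apply/seteqP; split=> r /=.
  by move=> [/xsectionP ? ?]; apply/xsectionP.
by move=> /xsectionP[? ?]; split=> //; apply/xsectionP.
Qed.

End uniform.

(** * The mixed stopping time inverse to a randomized stopping time *)

Section inverse_time.
Context {d : measure_display} {Omega : measurableType d} {R : realType}.
Context (P : probability Omega R) (T : R) (hT : 0 < T).
Context (F : R -> set (set Omega)) (hF : filtration T F).
Context (hU : usual_conditions P T F).
Context (rho : R -> Omega -> R) (hrho : randomized_stopping_time P T F rho).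
Implicit Types (N : set Omega) (t r : R) (w : Omega).

(** The value [T] outside the strip and above the null set [N] serves to make
    the function jointly measurable on all of [Omega * R]. *)
Definition inverse_time N (x : Omega * R) : R :=
  if (x.1 \notin N) && (x.2 \in `[0, 1])
  then first_passage T (rho^~ x.1) x.2 else T.

Let T_in : T \in `[0, T].
Proof. by rewrite in_itv/= lexx ltW. Qed.

Lemma inverse_time_range N x : inverse_time N x \in `[0, T].
Proof.
rewrite /inverse_time; case: ifPn => // /andP[_ x2].
apply: first_passage_range; first exact: ltW.
by rewrite (rand_end hrho) (itvP x2).
Qed.

Lemma inverse_time_le N w r t : ~ N w -> r \in `[0, 1] -> t \in `[0, T] ->
  (inverse_time N (w, r) <= t) = (r <= rho t w).
Proof.
move=> Nw r01 tT; rewrite /inverse_time/= r01 andbT ifT; last first.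
  by apply/negP => /set_mem.
apply: first_passage_le => //.
- exact: (rand_mono hrho).
- exact: (rand_right hrho).
- by rewrite (rand_end hrho) (itvP r01).
Qed.

Lemma randomized_version t : t \in `[0, T] ->
  exists g Z, [/\ forall B, measurable B -> F t (g @^-1` B), F t Z, P Z = 0%E &
    forall w, ~ Z w -> rho t w = g w].
Proof.
move=> tT; apply: completion_measurable_version.
- exact: (filtration_sigma hF).
- exact: (filtration_sub hF).
- exact: (rand_adapted hrho).
Qed.

(** Each [rho t] brings its own null set, so only countably many times may be
    used. They suffice: if [inverse_time < y <= T], a sampled time lies strictly
    in between, and [r] is below [rho] at that time. *)
Lemma measurable_inverse_time : exists N,
  [/\ measurable N, P N = 0%E & measurable_fun setT
    (inverse_time N : Omega * measurableTypeR R -> R)].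
Proof.
have [q qdense] := dense_sequence R.
(* A sequence of times that is dense in [[0, T]]. *)
pose s n := if q n \in `[0, T] then q n else T.
have sT n : s n \in `[0, T] by rewrite /s; case: ifPn.
have /choice[gZ hgZ] : forall n, exists gZ : (Omega -> R) * set Omega,
    [/\ forall B, measurable B -> F (s n) (gZ.1 @^-1` B), F (s n) gZ.2,
      P gZ.2 = 0%E & forall w, ~ gZ.2 w -> rho (s n) w = gZ.1 w].
  by move=> n; have [g [Z ?]] := randomized_version _ (sT n); exists (g, Z).
have mZ n : measurable (gZ n).2.
  by have [_ FZ _ _] := hgZ n; exact: (filtration_sub hF (sT n)).
pose N := \bigcup_n (gZ n).2.
have mN : measurable N by exact: bigcupT_measurable.
exists N; split=> //; first by apply: null_bigcup => // n; have [] := hgZ n.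
pose E n := [set x : Omega * measurableTypeR R |
  x.2 \in `[0, 1] /\ x.2 <= (gZ n).1 x.1].
have mE n : measurable (E n).
  apply: (prod_borel_sub _ (filtration_sub hF (sT n))).
  apply: prod_borel_subgraph; first exact: (filtration_sigma hF).
  by have [] := hgZ n.
have gE n w : ~ N w -> rho (s n) w = (gZ n).1 w.
  by move=> Nw; have [_ _ _] := hgZ n; apply => Znw; apply: Nw; exists n.
apply: (measurability _ (RGenInftyO.measurableE R)) => //=.
move=> _ [_ [y ->] <-]; rewrite setTI.
have [Ty|yT] := ltP T y.
  rewrite (_ : _ @^-1` _ = setT)//; apply/seteqP; split=> // x _ /=.
  by rewrite in_itv/= (le_lt_trans _ Ty)// (itvP (inverse_time_range N x)).
rewrite (_ : _ @^-1` _ =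
    (~` N `*` setT) `&` \bigcup_n (if s n < y then E n else set0)).
  apply: measurableI; first by apply: measurableX => //; exact: measurableC.
  by apply: bigcupT_measurable => n; case: ifPn.
apply/seteqP; split=> [[w r]|[w r] [/= [Nw _] [n _]]]; rewrite /= in_itv/=.
  move=> ity.
  have [/negP Nw r01] : w \notin N /\ r \in `[0, 1].
    apply/andP; move: ity; rewrite /inverse_time/=; case: ifPn => // _.
    by rewrite ltNge yT.
  have {}Nw : ~ N w by move=> /mem_set.
  split=> //; have [n /andP[itq qy]] := qdense _ _ ity.
  have sE : s n = q n.
    rewrite /s ifT// in_itv/= (le_trans _ (ltW itq)).
      exact: le_trans (ltW qy) yT.
    by rewrite (itvP (inverse_time_range N (w, r))).
  exists n => //; rewrite sE qy; split=> //=.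
  by rewrite -gE// -(inverse_time_le _ _ _ _ Nw)// sE ltW.
case: ifPn => // sy [/= r01 rg]; apply: le_lt_trans sy.
by rewrite inverse_time_le// gE.
Qed.

(* From here on [N] is any null set to be discarded. *)
Context (N : set Omega) (mN : measurable N) (N0 : P N = 0%E).

(** Off [N] and off the null set of [rho t], the set [{mu <= t}] is the region
    under the graph of an [F t]-measurable version of [rho t]. The usual
    conditions place [N] in [F t], as the completion demands. *)
Lemma mixed_stopping_time_inverse_time :
  mixed_stopping_time P T F (inverse_time N).
Proof.
split=> [w r _|t tT]; first exact: inverse_time_range.
have [g [Z [mg FZ Z0 rhog]]] := randomized_version _ tT.
have sF := filtration_sigma hF tT.
have Fm := filtration_sub hF tT.
have FN : F t N.
  apply: (filtration_mono hF _ tT) (usual_null hU mN N0).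
    by rewrite in_itv/= lexx ltW.
  by rewrite (itvP tT).
have [_ _ _ FI] := (sigma_algebraP (fun A _ => @subsetT _ A)).1 sF.
have [_ FC FU] := sF.
have FNZ : F t (N `|` Z).
  by rewrite -bigcup2E; apply: FU => -[|[|n]]//=; have [] := sF.
have NZ0 : P (N `|` Z) = 0%E.
  rewrite -bigcup2E; apply: null_bigcup => -[|[|n]]//=; exact: Fm.
have rect A B : F t A -> measurable B -> prod_borel (R := R) (F t) (A `*` B).
  by move=> FA mB; apply: sub_sigma_algebra; exists A => //; exists B.
pose S := [set x : Omega * R | x.2 \in `[0, 1] /\ inverse_time N x <= t].
pose S0 := [set x : Omega * R | x.2 \in `[0, 1] /\ x.2 <= g x.1].
pose D := (N `|` Z) `*` [set: R].
exists (S0 `&` (~` (N `|` Z) `*` setT)), D, (S `&` D); split.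
- have [_ _ _ GI] := (sigma_algebraP (fun A _ => @subsetT _ A)).1
    (smallest_sigma_algebra setT
      [set A `*` B | A in F t & B in (@measurable _ (measurableTypeR R))]).
  apply: GI; first exact: prod_borel_subgraph.
  by apply: rect => //; rewrite -setTD; exact: FC.
- exact: rect.
- rewrite /Plambda/= product_measure1E//; last exact: Fm.
  by rewrite [X in (X * _)%E]NZ0 mul0e.
- exact: subIsetr.
- have off w r : ~ (N `|` Z) w -> S (w, r) <-> S0 (w, r).
    move=> NZw; have Nw : ~ N w by move=> ?; apply: NZw; left.
    have Zw : ~ Z w by move=> ?; apply: NZw; right.
    by rewrite /S /S0/=; split=> -[r01]; rewrite inverse_time_le// rhog.
  apply/seteqP; split=> [[w r] Sx|[w r] [[S0x [/= NZw _]]|[]//]].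
    have [NZw|NZw] := pselect ((N `|` Z) w); first by right.
    by left; split=> //; exact/off.
  exact/off.
Qed.

Context (mit : measurable_fun setT
  (inverse_time N : Omega * measurableTypeR R -> R)).

Definition graph_map (x : Omega * measurableTypeR R) :
  Omega * measurableTypeR R := (x.1, inverse_time N x).

Lemma measurable_graph_map : measurable_fun setT graph_map.
Proof. exact: measurable_fun_pair. Qed.

HB.instance Definition _ := isMeasurableFun.Build _ _ _ _ graph_map
  measurable_graph_map.

(** Sampling [r] uniformly turns the mixed stopping time into a random one; this
    is the joint law of the scenario and the time. *)
Definition delta : probability (Omega * measurableTypeR R)%type R :=
  distribution (P \x uniform_prob (@ltr01 R))%E graph_map.

(** The section at [w] of the set [S t A] below is, for [w] in [A] off [N], the
    interval [[0, rho t w]], of length [rho t w]; integrating over [w] yields the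
    equation for [rho]. As [mu] is jointly measurable, outer measure is measure
    and the equation for [mu] is a change of variables. *)
Lemma equivalent_inverse_time : equivalent P T (inverse_time N) rho.
Proof.
exists delta.
pose S t A := [set x : Omega * measurableTypeR R |
  [/\ A x.1, x.2 \in `[0, 1] & inverse_time N x <= t]].
have SE t A : S t A =
    graph_map @^-1` (A `*` `[0, t]) `&` [set x | x.2 \in `[0, 1]].
  apply/seteqP; split=> [x [/= Ax x2 xt]|x [/= [/= Ax]]].
    split=> //; split=> //=.
    by rewrite in_itv/= xt (itvP (inverse_time_range N x)).
  by rewrite in_itv/= => /andP[_ xt] x2; split.
have mpre t A : measurable A -> measurable (graph_map @^-1` (A `*` `[0, t])).
  move=> mA; rewrite -[X in measurable X]setTI.
  by apply: measurable_graph_map => //; exact: measurableX.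
have mS t A : measurable A -> measurable (S t A).
  move=> mA; rewrite SE; apply: measurableI; first exact: mpre.
  rewrite (_ : [set _ | _] = setT `*` `[0, 1]); first exact: measurableX.
  by apply/seteqP; split=> x //= [].
have deltaE t A : measurable A -> delta (A `*` `[0, t]) = Plambda P (S t A).
  by move=> mA; rewrite SE -product_uniform_prob01E//; exact: mpre.
split=> t A tT mA; rewrite deltaE//.
  by rewrite measurable_mu_extE//; exact: mS.
rewrite [RHS]integral_mkcond; apply/esym.
apply: (ge0_integral_null_modification _ _ _ _ mN N0) => //.
- exact: measurable_fun_xsection (mS t A mA).
- move=> w; rewrite patchE; case: ifPn => // _.
  by rewrite lee_fin (itvP (rand_range hrho w tT)).
move=> w Nw; rewrite patchE /=.
case: ifPn => [/set_mem Aw|/negP Aw]; last first.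
  rewrite (_ : xsection _ _ = set0) ?measure0//; apply/seteqP; split=> r //.
  by move=> /xsectionP[/= /mem_set].
have rho01 := rand_range hrho w tT.
rewrite (_ : xsection _ _ = `[0, rho t w]%classic).
  rewrite lebesgue_measure_itv/= lte_fin; case: ltP => [_|rho0].
    by rewrite sube0.
  by congr EFin; apply/eqP; rewrite eq_le rho0 (itvP rho01).
apply/seteqP; split=> r.
  move=> /xsectionP[/= _ r01]; rewrite inverse_time_le// in_itv/= => ->.
  by rewrite (itvP r01).
rewrite /= in_itv/= => /andP[r0 rrho].
have r01 : r \in `[0, 1].
  by rewrite in_itv/= r0 (le_trans rrho)// (itvP rho01).
by apply/xsectionP; split=> //; rewrite inverse_time_le.
Qed.

End inverse_time.

Theorem theorem1 (d : measure_display) (Omega : measurableType d)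
    (R : realType) (P : probability Omega R) (T : R) (hT : 0 < T)
    (F : R -> set (set Omega)) (hF : filtration T F)
    (hU : usual_conditions P T F)
    (rho : R -> Omega -> R) (hrho : randomized_stopping_time P T F rho) :
  exists mu : Omega * R -> R,
    mixed_stopping_time P T F mu /\ equivalent P T mu rho.
Proof.
have [N [mN N0 mit]] := measurable_inverse_time P T hT F hF rho hrho.
exists (inverse_time T rho N); split.
  exact: (mixed_stopping_time_inverse_time P T hT F hF hU rho hrho N mN N0).
exact: (equivalent_inverse_time P T hT F rho hrho N mN N0 mit).
Qed.
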